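(* Let $G$ be a group, $Z$ a compact Hausdorff space, $\varphi: G \curvearrowright Z$ an action by homeomorphisms, $P$ the set of bounded parabolic points of $\varphi$, $P' \subseteq P$ a set of representatives of the orbits in $P$, and $H = \{H_{p}\}_{p \in P'}$ a family of minimal subsets $H_p\subseteq G$ with $1\in H_p$ and $\{\varphi(h,p):h\in H_p\}= Orb_{\varphi}\, p$. Then the assignment $$\varphi\ltimes: \prod_{p\in P'}EPers(Stab_{\varphi}p) \rightarrow Act(G)$$ sending a family $\{Stab_{\varphi}p+_{\partial_{p}}C_{p}\}_{p\in P'}$ of objects, with actions $\eta = \{\eta_{p}\}_{p\in P'}$ on the $C_p$, to the parabolic blowup action $\varphi\ltimes\eta$, and a family of morphisms $\phi=\{\mathrm{id}+\phi_p\}_{p\in P'}$ to the induced map $\varphi\ltimes \phi$ between parabolic blowups, is a functor.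
   Context: Groups are discrete. An action of a group $H$ on a locally compact Hausdorff space $V$ is properly discontinuous if for every compact $K\subseteq V$ the set $\{h\in H: hK\cap K\neq\emptyset\}$ is finite, and cocompact if $HK=V$ for some compact $K\subseteq V$. A point $p\in Z$ is bounded parabolic for $\varphi:G\curvearrowright Z$ if $Stab_\varphi p$ acts properly discontinuously and cocompactly on $Z\setminus\{p\}$. A compact Hausdorff space has a unique compatible uniform structure; for an entourage $u$, a subset $A$ is $u$-small if $A\times A\subseteq u$. Gluing notation: $V+_fC$ denotes a topological space with underlying set $V\sqcup C$ in which $V$ is open and $V$, $C$ carry their given topologies; $f$ records the topology via $f(A)=\overline{A}\cap C$ for $A$ closed in $V$ (so $B$ is closed iff $B\cap V$, $B\cap C$ are closed in $V$, $C$ and $f(B\cap V)\subseteq B$). $Act(G)$: the category of actions of $G$ by homeomorphisms on compact Hausdorff spaces, with continuous equivariant maps. $EPers(H)$, for a discrete group $H$: objects are compact Hausdorff spaces $H+_\partial C$ with an action $L+\eta$ of $H$ by homeomorphisms ($L$ left multiplication on $H$, $\eta$ an action on $C$) such that for every entourage $u$ and every finite $F\subseteq H$, $hF$ is $u$-small for all but finitely many $h\in H$; morphisms are continuous maps $\mathrm{id}+\phi:H+_{\partial}C\to H+_{\partial'}C'$ which are the identity on $H$ and an equivariant map $\phi:C\to C'$. Given $H+_\partial C\in EPers(H)$ and a properly discontinuous cocompact action of $H$ on a locally compact Hausdorff $V$ with compact $K\subseteq V$ such that $HK=V$, let $V+_{\partial_\Pi}C$ be the gluing given by $\partial_\Pi(S)=\partial(\{h\in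 H: hK\cap S\neq\emptyset\})$ for $S$ closed in $V$; it is compact Hausdorff and independent of $K$. Parabolic blowup: for $p\in P'$ and $q\in Orb_\varphi p$ let $h_{p,q}$ be the unique element of $H_p$ with $\varphi(h_{p,q},p)=q$ (so $h_{p,p}=1$); put $C_q=C_p$ and let $Stab_\varphi q+_{\partial_q}C_q$ have the topology making the map $x\mapsto h_{p,q}^{-1}xh_{p,q}$ on $Stab_\varphi q$ together with $\mathrm{id}$ on $C_q=C_p$ a homeomorphism onto $Stab_\varphi p+_{\partial_p}C_p$. Let $X_q=(Z\setminus\{q\})+_{(\partial_q)_\Pi}C_q$ and let $\pi_q:X_q\to Z$ be the identity on $Z\setminus\{q\}$ and send $C_q$ to $q$. The blowup space is the inverse limit $Z\ltimes\mathcal C=\{(z,(x_q)_{q\in P}): \pi_q(x_q)=z\ \forall q\}\subseteq Z\times\prod_{q\in P} X_q$, where $\mathcal C=\{C_p\}_{p\in P'}$. $G$ acts on it by $\varphi\ltimes\eta$, induced by $\varphi$ and the maps $\psi_q(g,\cdot):X_q\to X_{\varphi(g,q)}$ equal to $\varphi(g,\cdot)$ on $Z\setminus\{q\}$ and to $\eta_p(h_{p,\varphi(g,q)}^{-1}gh_{p,q},\cdot)$ on $C_q$. Given morphisms $\mathrm{id}+\phi_p:Stab_\varphi p+_{\partial_p}C_p\to Stab_\varphi p+_{\partial'_p}C'_p$ ($p\in P'$), put $\phi_q=\phi_p$ for $q\in Orb_\varphi p$; the map $\varphi\ltimes\phi:Z\ltimes\mathcal C\to Z\ltimes\mathcal C'$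 is the one induced on inverse limits by $\mathrm{id}_Z$ and the maps $\mathrm{id}+\phi_q:X_q\to X'_q$ ($q\in P$). *)

(* Defs.v *)
(* For [A : set T], [A] also denotes the subtype of its points, with the
   subspace topology.  [groupType] does not assume finiteness. *)
From HB Require Import structures.
From mathcomp Require Import all_boot.
From mathcomp Require Import all_classical topology.

Set Implicit Arguments.
Unset Strict Implicit.
Unset Printing Implicit Defensive.

Local Open Scope classical_set_scope.
Local Open Scope group_scope.

Record category := Category {
  Ob :> Type;
  Hom : Ob -> Ob -> Type;
  idm : forall X, Hom X X;
  comp : forall X Y W, Hom Y W -> Hom X Y -> Hom X W;
  comp_idl : forall X Y (f : Hom X Y), comp (idm Y) f = f;
  comp_idr : forall X Y (f : Hom X Y), comp f (idm X) = f;
  compA : forall X Y W T (f : Hom X Y) (g : Hom Y W) (h : Hom W T),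
    comp h (comp g f) = comp (comp h g) f }.

Arguments Hom {_} _ _.
Arguments idm {_} _.
Arguments comp {_ _ _ _} _ _.

Definition is_functor (C D : category) (F0 : C -> D)
    (F1 : forall X Y : C, Hom X Y -> Hom (F0 X) (F0 Y)) : Prop :=
  (forall X, F1 X X (idm X) = idm (F0 X)) /\
  (forall X Y W (f : Hom X Y) (g : Hom Y W),
     F1 X W (comp g f) = comp (F1 Y W g) (F1 X Y f)).

Section ProductCategory.
Variables (I : Type) (C : I -> category).
Implicit Types X Y : forall i, C i.

Lemma prod_comp_idl X Y (f : forall i, Hom (X i) (Y i)) :
  (fun i => comp (idm (Y i)) (f i)) = f.
Proof. by apply: functional_extensionality_dep => i; exact: comp_idl. Qed.

Lemma prod_comp_idr X Y (f : forall i, Hom (X i) (Y i)) :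
  (fun i => comp (f i) (idm (X i))) = f.
Proof. by apply: functional_extensionality_dep => i; exact: comp_idr. Qed.

Lemma prod_compA X Y (W T : forall i, C i) (f : forall i, Hom (X i) (Y i))
    (g : forall i, Hom (Y i) (W i)) (h : forall i, Hom (W i) (T i)) :
  (fun i => comp (h i) (comp (g i) (f i))) =
  (fun i => comp (comp (h i) (g i)) (f i)).
Proof. by apply: functional_extensionality_dep => i; exact: compA. Qed.

Definition prod_category : category :=
  @Category (forall i, C i) (fun X Y => forall i, Hom (X i) (Y i))
    (fun X i => idm (X i)) (fun X Y W g f i => comp (g i) (f i))
    prod_comp_idl prod_comp_idr prod_compA.

End ProductCategory.

Definition is_action (G : groupType) (X : Type) (a : G -> X -> X) : Prop :=
  (forall x, a 1 x = x) /\ (forall g h x, a (g * h) x = a g (a h x)).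

(* Each [a g] is then a homeomorphism, with inverse [a g^-1]. *)
Definition homeo_action (G : groupType) (X : topologicalType)
    (a : G -> X -> X) : Prop :=
  is_action a /\ forall g, continuous (a g).

Record action (G : groupType) (X : topologicalType) := Action {
  act_fun :> G -> X -> X;
  actP : homeo_action act_fun }.

Section ActionTheory.
Variables (G : groupType) (X : topologicalType) (a : action G X).

Lemma act1 x : a 1 x = x. Proof. exact: (actP a).1.1. Qed.
Lemma actM g h x : a (g * h) x = a g (a h x). Proof. exact: (actP a).1.2. Qed.
Lemma act_continuous g : continuous (a g). Proof. exact: (actP a).2. Qed.
Lemma actK g : cancel (a g) (a g^-1).
Proof. by move=> x; rewrite -actM mulVg act1. Qed.
Lemma actVK g : cancel (a g^-1) (a g).
Proof. by move=> x; rewrite -actM mulgV act1. Qed.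

Definition orbit x : set X := range (a^~ x).

Definition properly_discontinuous : Prop :=
  forall K : set X, compact K ->
    finite_set [set h : G | (a h @` K) `&` K !=set0].

Definition fundamental_compact (K : set X) : Prop :=
  compact K /\ \bigcup_h (a h @` K) = [set: X].

Definition cocompact : Prop := exists K, fundamental_compact K.

Definition stab x : set G := [set g | a g x = x].
Definition Stab x : Type := stab x.

End ActionTheory.

Section StabGroup.
Variables (G : groupType) (X : topologicalType) (a : action G X) (x : X).

HB.instance Definition _ := SubChoice.copy (Stab a x) {g : G | g \in stab a x}.

Lemma stab_group_closed : group_closed (fun g : G => g \in stab a x).
Proof.
split=> [|g h]; rewrite ?unfold_in /= !inE /stab/= ?act1//.
by move=> gx hx; rewrite actM -{1}hx actK.
Qed.

HB.instance Definition _ :=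
  SubChoice_isSubGroup.Build G _ (Stab a x) stab_group_closed.

Definition mkStab g (gx : a g x = x) : Stab a x := exist _ g (mem_set gx).

Lemma StabP (s : Stab a x) : a (val s) x = x.
Proof. by have := valP s; rewrite inE. Qed.

End StabGroup.

(* The topologies on the disjoint union of [V] and [C] in which [V] is open and
   both pieces carry their given topology correspond to the maps
   [f A = closure A `&` C] ([A] closed in [V]); see [gluing_closedP] and
   [gluing_closure].  The value of [f] at a set which is not closed is
   irrelevant. *)
Record gluing_map (V C : topologicalType) := GluingMap {
  gl_fun :> set V -> set C;
  gl0 : gl_fun set0 = set0;
  glU : forall A B, closed A -> closed B ->
    gl_fun (A `|` B) = gl_fun A `|` gl_fun B;
  gl_closed : forall A, closed A -> closed (gl_fun A) }.

Definition gluing (V C : topologicalType) (f : gluing_map V C) : Type :=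
  (V + C)%type.

Section GluingTopology.
Variables (V C : topologicalType) (f : gluing_map V C).

Definition glV (v : V) : gluing f := inl v.
Definition glC (c : C) : gluing f := inr c.

HB.instance Definition _ := Choice.copy (gluing f) (V + C)%type.

Lemma gl_sub A B : closed A -> closed B -> A `<=` B -> f A `<=` f B.
Proof. by move=> cA cB /setUidPr <-; rewrite glU//; left. Qed.

Definition gluing_open (U : set (gluing f)) : Prop :=
  [/\ open (glV @^-1` U), open (glC @^-1` U) &
      f (glV @^-1` (~` U)) `<=` glC @^-1` (~` U)].

Lemma gluing_openT : gluing_open setT.
Proof.
split; [exact: openT|exact: openT|].
by rewrite setCT preimage_set0 gl0; exact: sub0set.
Qed.

Lemma gluing_openI : setI_closed gluing_open.
Proof.
move=> A B [oA1 oA2 fA] [oB1 oB2 fB]; split; [exact: openI|exact: openI|].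
rewrite setCI !preimage_setU glU.
- exact: setUSS.
- by rewrite preimage_setC; exact: open_closedC.
- by rewrite preimage_setC; exact: open_closedC.
Qed.

Lemma gluing_open_bigU (I : Type) (F : I -> set (gluing f)) :
  (forall i, gluing_open (F i)) -> gluing_open (\bigcup_i F i).
Proof.
move=> oF; have oV : open (glV @^-1` (\bigcup_i F i)).
  by rewrite preimage_bigcup; apply: bigcup_open => i _; have [] := oF i.
split=> //.
  by rewrite preimage_bigcup; apply: bigcup_open => i _; have [] := oF i.
move=> c fc /= [i _ Fic]; have [oVi _ fi] := oF i.
apply: (fi c _ Fic); apply: gl_sub fc.
- by rewrite preimage_setC; exact: open_closedC.
- by rewrite preimage_setC; exact: open_closedC.
- by apply: preimage_subset; apply: subsetC; exact: bigcup_sup.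
Qed.

HB.instance Definition _ := isOpenTopological.Build (gluing f)
  gluing_openT gluing_openI gluing_open_bigU.

Lemma gluing_closedP (B : set (gluing f)) :
  closed B <->
  [/\ closed (glV @^-1` B), closed (glC @^-1` B) &
      f (glV @^-1` B) `<=` glC @^-1` B].
Proof.
have -> : closed B <-> gluing_open (~` B) by rewrite -openC.
rewrite /gluing_open setCK.
split=> -[oV oC fB]; split=> //.
- by rewrite -openC; exact: oV.
- by rewrite -openC; exact: oC.
- by rewrite preimage_setC openC.
- by rewrite preimage_setC openC.
Qed.

Lemma gluing_closure (A : set V) : closed A ->
  glC @^-1` closure (glV @` A) = f A.
Proof.
move=> cA; have cAf : closed ((glV @` A `|` glC @` f A) : set (gluing f)).
  have EV : glV @^-1` (glV @` A `|` glC @` f A) = A.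
    apply/seteqP; split=> [v [[w Aw [<-]]//|[c _ //]]|v Av].
    by left; exists v.
  have EC : glC @^-1` (glV @` A `|` glC @` f A) = f A.
    apply/seteqP; split=> [v [[w Aw //]|[c fc [<-]//]]|v Av].
    by right; exists v.
  by apply/gluing_closedP; rewrite EV EC; split=> //; exact: gl_closed.
apply/seteqP; split=> [c /= clc|c fc /=].
  have /closure_subset/(_ _ clc) :
    ((glV @` A : set (gluing f)) `<=` glV @` A `|` glC @` f A).
    exact: subsetUl.
  by rewrite -((closure_id _).1 cAf) => -[[v _ //]|[d fd [<-]]].
have /gluing_closedP[cV _ +] := @closed_closure _ (glV @` A : set (gluing f)).
apply; apply: gl_sub fc => // v Av; apply: subset_closure.
by exists v.
Qed.

End GluingTopology.

Arguments glV {V C f} v.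
Arguments glC {V C f} c.

Definition glue (V C V' C' : topologicalType) (f : gluing_map V C)
    (f' : gluing_map V' C') (a : V -> V') (b : C -> C') :
    gluing f -> gluing f' :=
  fun x => match x with inl v => glV (a v) | inr c => glC (b c) end.

Arguments glue {V C V' C'} f f' a b x.

(* Transport of a gluing of a discrete set along a bijection [f]; see
   [pull_gluing_homeo]. *)
Section PullGluing.
Variables (A B : choiceType) (f : A -> B) (C : topologicalType).
Variable d : gluing_map (discrete_topology B) C.

Definition pull_fun (S : set (discrete_topology A)) : set C := d (f @` S).

Lemma pull0 : pull_fun set0 = set0.
Proof. by rewrite /pull_fun image_set0 gl0. Qed.

Lemma pullU S T : closed S -> closed T ->
  pull_fun (S `|` T) = pull_fun S `|` pull_fun T.
Proof. by move=> _ _; rewrite /pull_fun image_setU glU //; exact: discrete_closed. Qed.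

Lemma pull_closed S : closed S -> closed (pull_fun S).
Proof. by move=> _; apply: gl_closed; exact: discrete_closed. Qed.

Definition pull_gluing : gluing_map (discrete_topology A) C :=
  GluingMap pull0 pullU pull_closed.

Lemma pull_gluing_homeo (g : B -> A) : cancel f g -> cancel g f ->
  continuous (glue pull_gluing d f id) /\ continuous (glue d pull_gluing g id).
Proof.
move=> fK gK; split; apply/continuousP => U [_ oC dU]; split;
    do ?[exact: discrete_open|exact: oC].
  apply: subset_trans dU; rewrite /= /pull_fun.
  apply: gl_sub; try exact: discrete_closed.
  by move=> _ [x /= nUx <-].
apply: subset_trans dU; rewrite /= /pull_fun.
apply: gl_sub; try exact: discrete_closed.
by move=> x /= nUx; exists (g x).
Qed.

End PullGluing.

Section PiGluing.
Variables (H : groupType) (V C : topologicalType) (a : action H V) (K : set V).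
Variable d : gluing_map (discrete_topology H) C.

Definition hits (S : set V) : set (discrete_topology H) :=
  [set h | (a h @` K) `&` S !=set0].

Definition Pi_fun (S : set V) : set C := d (hits S).

Lemma Pi0 : Pi_fun set0 = set0.
Proof.
rewrite /Pi_fun (_ : hits set0 = set0) ?gl0//.
by rewrite -subset0 => h [x []].
Qed.

Lemma PiU S T : closed S -> closed T -> Pi_fun (S `|` T) = Pi_fun S `|` Pi_fun T.
Proof.
move=> _ _; rewrite /Pi_fun -glU; [|exact: discrete_closed|exact: discrete_closed].
congr (d _); apply/seteqP; split=> [h [x [Kx [Sx|Tx]]]|h [[x [Kx Sx]]|[x [Kx Tx]]]].
- by left; exists x.
- by right; exists x.
- by exists x; split=> //; left.
- by exists x; split=> //; right.
Qed.

Lemma Pi_closed S : closed S -> closed (Pi_fun S).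
Proof. by move=> _; apply: gl_closed; exact: discrete_closed. Qed.

Definition Pi_gluing : gluing_map V C := GluingMap Pi0 PiU Pi_closed.

End PiGluing.

Section Act.
Variable G : groupType.

Definition act_object (X : topologicalType) (a : G -> X -> X) : Prop :=
  [/\ compact [set: X], hausdorff_space X & homeo_action a].

Record act_ob := ActOb {
  ao_space :> topologicalType;
  ao_act : G -> ao_space -> ao_space;
  ao_axiom : act_object ao_act }.

Definition act_morphism (X Y : topologicalType) (a : G -> X -> X)
    (b : G -> Y -> Y) (f : X -> Y) : Prop :=
  continuous f /\ forall g x, f (a g x) = b g (f x).

Record act_hom (X Y : act_ob) := ActHom {
  ah_fun :> X -> Y;
  ah_axiom : act_morphism (@ao_act X) (@ao_act Y) ah_fun }.

Lemma act_hom_eq X Y (f g : act_hom X Y) : ah_fun f = ah_fun g -> f = g.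
Proof.
case: f g => [f fP] [g gP] /= fg; case: g / fg gP => gP.
by congr ActHom; exact: Prop_irrelevance.
Qed.

Lemma act_id_axiom (X : act_ob) : act_morphism (@ao_act X) (@ao_act X) id.
Proof. by split=> // x; exact: cvg_id. Qed.

Lemma act_comp_axiom (X Y W : act_ob) (g : act_hom Y W) (f : act_hom X Y) :
  act_morphism (@ao_act X) (@ao_act W) (g \o f).
Proof.
case: f g => [f [fc fE]] [g [gc gE]] /=; split=> [x|h x] /=.
  by apply: continuous_comp; [exact: fc|exact: gc].
by rewrite fE gE.
Qed.

Program Definition Act : category :=
  @Category act_ob act_hom (fun X => ActHom (act_id_axiom X))
    (fun X Y W g f => ActHom (act_comp_axiom g f)) _ _ _.
Next Obligation. by move=> *; exact: act_hom_eq. Qed.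
Next Obligation. by move=> *; exact: act_hom_eq. Qed.
Next Obligation. by move=> *; exact: act_hom_eq. Qed.

End Act.

Definition compatible_uniformity (T : topologicalType)
    (ent : set_system (T * T)) : Prop :=
  [/\ Filter ent,
      forall A, ent A -> diagonal `<=` A,
      forall A, ent A -> ent (A^-1)%relation,
      forall A, ent A -> exists2 B, ent B & (B \; B `<=` A)%relation &
      @nbhs T T = nbhs_ ent].

(* On a compact Hausdorff space there is exactly one compatible uniformity. *)
Definition is_entourage (T : topologicalType) (u : set (T * T)) : Prop :=
  exists2 ent, compatible_uniformity ent & ent u.

Section EPers.
Variable H : groupType.

(* [L + eta] *)
Definition left_act (C : topologicalType)
    (d : gluing_map (discrete_topology H) C) (eta : H -> C -> C) (h : H) :
    gluing d -> gluing d :=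
  glue d d (fun x : H => h * x) (eta h).

Arguments left_act {C} d eta h _.

Definition perspective (C : topologicalType)
    (d : gluing_map (discrete_topology H) C) : Prop :=
  forall u : set (gluing d * gluing d), is_entourage u ->
  forall F : set H, finite_set F ->
  let tr h : set (gluing d) := [set @glV _ _ d (h * x) | x in F] in
  finite_set [set h : H | ~ (tr h `*` tr h `<=` u)].

Record epers_ob := EPersOb {
  ep_C : topologicalType;
  ep_d : gluing_map (discrete_topology H) ep_C;
  ep_eta : H -> ep_C -> ep_C;
  ep_compact : compact [set: gluing ep_d];
  ep_hausdorff : hausdorff_space (gluing ep_d);
  ep_act : homeo_action (left_act ep_d ep_eta);
  ep_perspective : perspective ep_d }.

Record epers_hom (X Y : epers_ob) := EPersHom {
  eh_fun :> ep_C X -> ep_C Y;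
  eh_continuous : continuous (glue (ep_d X) (ep_d Y) id eh_fun);
  eh_equivariant : forall h c,
    eh_fun (@ep_eta X h c) = @ep_eta Y h (eh_fun c) }.

Lemma epers_hom_eq X Y (f g : epers_hom X Y) : eh_fun f = eh_fun g -> f = g.
Proof.
case: f g => [f f1 f2] [g g1 g2] /= fg; case: g / fg g1 g2 => g1 g2.
by congr EPersHom; exact: Prop_irrelevance.
Qed.

Lemma glue_id (V C : topologicalType) (d : gluing_map V C) :
  glue d d id id = id.
Proof. by apply/funext => -[]. Qed.

Lemma glue_comp (V C V' C' V'' C'' : topologicalType) (d : gluing_map V C)
    (d' : gluing_map V' C') (d'' : gluing_map V'' C'') a b a' b' :
  glue d' d'' a' b' \o glue d d' a b = glue d d'' (a' \o a) (b' \o b).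
Proof. by apply/funext => -[]. Qed.

Lemma epers_id_continuous (X : epers_ob) :
  continuous (glue (ep_d X) (ep_d X) id id).
Proof. by rewrite glue_id => x. Qed.

Lemma epers_comp_continuous X Y W (g : epers_hom Y W) (f : epers_hom X Y) :
  continuous (glue (ep_d X) (ep_d W) id (g \o f)).
Proof.
rewrite -[id]/(id \o id) -(glue_comp (ep_d X) (ep_d Y)) => x.
by apply: continuous_comp; exact: eh_continuous.
Qed.

Lemma epers_comp_equivariant X Y W (g : epers_hom Y W) (f : epers_hom X Y) h c :
  (g \o f) (@ep_eta X h c) = @ep_eta W h ((g \o f) c).
Proof. by rewrite /= !eh_equivariant. Qed.

Program Definition EPers : category :=
  @Category epers_ob epers_hom
    (fun X => EPersHom (@epers_id_continuous X) (fun _ _ => erefl))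
    (fun X Y W g f => EPersHom (@epers_comp_continuous X Y W g f)
                        (epers_comp_equivariant g f)) _ _ _.
Next Obligation. by move=> *; exact: epers_hom_eq. Qed.
Next Obligation. by move=> *; exact: epers_hom_eq. Qed.
Next Obligation. by move=> *; exact: epers_hom_eq. Qed.

End EPers.

Definition punctured (Z : topologicalType) (q : Z) : topologicalType :=
  [set~ q] : set Z.

Section Parabolic.
Variables (G : groupType) (Z : topologicalType) (phi : action G Z).

Lemma move_neq g (q q' z : Z) : phi g q = q' -> z <> q -> phi g z <> q'.
Proof. by move=> <- nzq /(can_inj (actK phi g)). Qed.

Definition punctured_move (g : G) (q q' : Z) (e : phi g q = q')
    (z : punctured q) : punctured q' :=
  exist _ (phi g (\val z)) (mem_set (move_neq e (set_mem (valP z)))).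

Lemma punctured_move_continuous g q q' (e : phi g q = q') :
  continuous (punctured_move e).
Proof.
apply/continuousP => _ [U oU <-].
have /continuousP/(_ U oU) oW := @act_continuous _ _ phi g.
by exists (phi g @^-1` U).
Qed.

Lemma stab_act_homeo q : @homeo_action (Stab phi q) (punctured q)
  (fun s => punctured_move (StabP s)).
Proof.
split; first split=> [x|s t x]; try by apply: val_inj; rewrite /= ?act1 ?actM.
by move=> s; exact: punctured_move_continuous.
Qed.

Definition stab_act q : action (Stab phi q) (punctured q) :=
  Action (stab_act_homeo q).

Definition bounded_parabolic : set Z := [set p |
  properly_discontinuous (stab_act p) /\ cocompact (stab_act p)].

Lemma bounded_parabolic_orbit p q :
  orbit phi p q -> bounded_parabolic p -> bounded_parabolic q.
Proof.
move=> [g _ e] [pd [K [cK KT]]].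
have e' : phi g^-1 q = p by rewrite -e actK.
have moveK z : punctured_move e (punctured_move e' z) = z.
  by apply: val_inj; rewrite /= actVK.
have moveM z : punctured_move e' (punctured_move e z) = z.
  by apply: val_inj; rewrite /= actK.
have cP (t : Stab phi p) : phi (g * \val t * g^-1) q = q.
  by rewrite !actM e' StabP.
have conjE (t : Stab phi p) z :
    stab_act q (mkStab (cP t)) (punctured_move e z) =
    punctured_move e (stab_act p t z).
  by apply: val_inj; rewrite /= !actM actK.
have conj_surj (s : Stab phi q) : exists t, s = mkStab (cP t).
  have sP : phi (g^-1 * \val s * g) p = p by rewrite !actM e StabP -e actK.
  exists (mkStab sP); apply: val_inj => /=.
  by rewrite !mulgA mulgV mul1g -!mulgA mulgV mulg1.
have cimg (A B : topologicalType) (f : A -> B) (L : set A) :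
    continuous f -> compact L -> compact (f @` L).
  by move=> cf; apply: continuous_compact; exact: continuous_subspaceT.
split=> [L cL|].
  have := pd _ (cimg _ _ _ _ (@punctured_move_continuous _ _ _ e') cL).
  move=> /(finite_image (fun t => mkStab (cP t))); apply: sub_finite_set.
  move=> s [_ [[z Lz <-] Lsz]]; have [t st] := conj_surj s; exists t => //.
  exists (punctured_move e' (stab_act q s z)); split; last first.
    by exists (stab_act q s z).
  exists (punctured_move e' z); first by exists z.
  by rewrite st -[z in RHS]moveK conjE moveM.
exists (punctured_move e @` K); split.
  by apply: cimg cK; exact: punctured_move_continuous.
apply/seteqP; split=> // z _.
have : [set: punctured p] (punctured_move e' z) by [].
rewrite -KT => -[t _ [x Kx tx]]; exists (mkStab (cP t)) => //.
exists (punctured_move e x); first by exists x.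
by rewrite conjE tx moveK.
Qed.

Definition orbit_representatives (P P' : set Z) : Prop :=
  P' `<=` P /\ forall q, P q -> exists! p, P' p /\ orbit phi p q.

Definition orbit_cover (p : Z) (S : set G) : Prop :=
  S 1 /\ [set phi h p | h in S] = orbit phi p.

Definition minimal_orbit_cover (p : Z) (S : set G) : Prop :=
  orbit_cover p S /\ forall T, orbit_cover p T -> T `<=` S -> T = S.

End Parabolic.

Section Blowup.
Variables (G : groupType) (Z : topologicalType) (phi : action G Z).
Variables (P' : set Z) (H : P' -> set G).
Hypothesis HH : forall p : P', minimal_orbit_cover phi (\val p) (H p).
Variable K : forall q : Z, set (punctured q).

Local Notation orb p := (orbit phi (\val p) : Type).

Lemma transporter_exists (p : P') (q : orb p) :
  exists h, H p h /\ phi h (\val p) = \val q.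
Proof.
have [[_ E] _] := HH p.
by have [_] := (seteqP _ _).1 E => /(_ _ (set_mem (valP q)))[h Hh hq]; exists h.
Qed.

(* [h_{p,q}] *)
Definition transporter (p : P') (q : orb p) : G :=
  projT1 (cid (transporter_exists q)).

Lemma transporterP (p : P') (q : orb p) :
  H p (transporter q) /\ phi (transporter q) (\val p) = \val q.
Proof. exact: projT2 (cid (transporter_exists q)). Qed.

Lemma transporter_uniq (p : P') (q : orb p) h :
  H p h -> phi h (\val p) = \val q -> h = transporter q.
Proof.
move=> Hh hq; have [Hk kq] := transporterP q; set k := transporter q in Hk kq *.
have [[H1 HE] Hmin] := HH p.
have rm x y : H p x -> H p y -> x <> y -> y <> 1 ->
    phi x (\val p) = phi y (\val p) -> False.
  move=> Hx Hy xy y1 pxy.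
  have /Hmin/(_ (@subDsetl _ _ _)) E : orbit_cover phi (\val p) (H p `\ y).
    split; first by split=> // /esym.
    rewrite -HE; apply/seteqP; split=> [_ [z [Hz _] <-]|_ [z Hz <-]].
      by exists z.
    have [->|zy] := pselect (z = y); first by exists x; rewrite ?pxy.
    by exists z.
  by move: Hy; rewrite -E => -[_]; apply.
apply: contrapT => hk; have [k1|k1] := pselect (k = 1).
  by apply: (@rm k h) => //; [exact/nesym|rewrite -k1; exact: hk|rewrite kq hq].
by apply: (@rm h k) => //; rewrite hq kq.
Qed.

Lemma holonomy_stab (p : P') (q q' : orb p) g : phi g (\val q) = \val q' ->
  phi ((transporter q')^-1 * g * transporter q) (\val p) = \val p.
Proof.
move=> e; rewrite -mulgA !actM (transporterP q).2 e.
by rewrite -(transporterP q').2 actK.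
Qed.

(* [h_{p,q'}^-1 * g * h_{p,q}] as an element of the stabilizer of [p] *)
Definition holonomy (p : P') (q q' : orb p) g (e : phi g (\val q) = \val q') :
  Stab phi (\val p) := mkStab (holonomy_stab e).

(* [x |-> h_{p,q}^-1 * x * h_{p,q}] *)
Definition stab_conj (p : P') (q : orb p) (s : Stab phi (\val q)) :
  Stab phi (\val p) := holonomy (StabP s).

Lemma stab_conj_bij (p : P') (q : orb p) : bijective (@stab_conj p q).
Proof.
have Pq (s : Stab phi (\val p)) :
    phi (transporter q * \val s * (transporter q)^-1) (\val q) = \val q.
  have e : phi (transporter q)^-1 (\val q) = \val p.
    by rewrite -(transporterP q).2 actK.
  by rewrite !actM e StabP (transporterP q).2.
exists (fun s => mkStab (Pq s)) => s; apply: val_inj => /=.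
  by rewrite !mulgA mulgV mul1g -!mulgA mulgV mulg1.
by rewrite !mulgA mulVg mul1g -!mulgA mulVg mulg1.
Qed.

(* The index set of the product: the pairs [(p, q)] with [p] in [P'] and [q] in
   the orbit of [p] correspond to the points [q] of [P], see [blow_index_bij]. *)
Definition blow_index : Type := {p : P' & orb p}.

Section BlowupSpace.
Variable X : forall p : P', EPers (Stab phi (\val p)).

(* The boundary map of the topology on the stabilizer of [q] transported from
   that of [p] by [stab_conj], with [C_q = C_p]. *)
Definition blow_d (p : P') (q : orb p) :
    gluing_map (discrete_topology (Stab phi (\val q))) (ep_C (X p)) :=
  pull_gluing (@stab_conj p q) (ep_d (X p)).

(* [X_q], with [C_q = C_p] *)
Definition blow_at (p : P') (q : orb p) : topologicalType :=
  gluing (Pi_gluing (stab_act phi (\val q)) (@K (\val q)) (blow_d q)).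

Definition blow_proj (p : P') (q : orb p) (x : blow_at q) : Z :=
  match x with inl z => \val z | inr _ => \val q end.

Definition blow_compatible :
    set (Z * prod_topology (fun i : blow_index => blow_at (projT2 i))) :=
  [set zx | forall i, blow_proj (zx.2 i) = zx.1].

Definition blowup : topologicalType := blow_compatible.

(* [psi_q(g, -)], with values in [X_{q'}] for [q' = phi g q] *)
Definition blow_move (p : P') (q q' : orb p) g (e : phi g (\val q) = \val q') :
    blow_at q -> blow_at q' :=
  glue _ _ (punctured_move e) (@ep_eta _ (X p) (holonomy e)).

Lemma blow_move_proj (p : P') (q q' : orb p) g
    (e : phi g (\val q) = \val q') x :
  blow_proj (blow_move e x) = phi g (blow_proj x).
Proof. by case: x. Qed.

Lemma orbit_pred_subproof (p : P') g (q : orb p) :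
  orbit phi (\val p) (phi g^-1 (\val q)).
Proof. by have [h _ <-] := set_mem (valP q); exists (g^-1 * h); rewrite ?actM. Qed.

Definition orbit_pred (p : P') g (q : orb p) : orb p :=
  exist _ (phi g^-1 (\val q)) (mem_set (orbit_pred_subproof g q)).

Lemma orbit_predK (p : P') g (q : orb p) :
  phi g (\val (orbit_pred g q)) = \val q.
Proof. exact: actVK. Qed.

(* The coordinate of [g x] at [q] is [psi_{q0}(g, x_{q0})], [q0 = phi g^-1 q]. *)
Definition blowup_act_fun g
    (zx : Z * prod_topology (fun i : blow_index => blow_at (projT2 i))) :
    Z * prod_topology (fun i : blow_index => blow_at (projT2 i)) :=
  (phi g zx.1,
   fun i : blow_index => blow_move (orbit_predK g (projT2 i))
     (zx.2 (existT _ (projT1 i) (orbit_pred g (projT2 i))))).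

Lemma blowup_act_subproof g (x : blowup) :
  blow_compatible (blowup_act_fun g (\val x)).
Proof.
move=> i /=; rewrite blow_move_proj; congr (phi g _).
exact: (set_mem (valP x)).
Qed.

Definition blowup_act g (x : blowup) : blowup :=
  exist _ (blowup_act_fun g (\val x)) (mem_set (blowup_act_subproof g x)).

End BlowupSpace.

Section BlowupMap.
Variables X Y : forall p : P', EPers (Stab phi (\val p)).
Variable f : forall p : P', Hom (X p) (Y p).

(* [id + phi_q : X_q -> X'_q] *)
Definition blow_map (p : P') (q : orb p) : blow_at X q -> blow_at Y q :=
  glue _ _ id (f p).

Definition blowup_map_fun
    (zx : Z * prod_topology (fun i : blow_index => blow_at X (projT2 i))) :
    Z * prod_topology (fun i : blow_index => blow_at Y (projT2 i)) :=
  (zx.1, fun i : blow_index => blow_map (zx.2 i)).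

Lemma blowup_map_subproof (x : blowup X) :
  @blow_compatible Y (blowup_map_fun (\val x)).
Proof.
move=> i /=; rewrite -(set_mem (valP x) i).
by case: ((\val x).2 i).
Qed.

Definition blowup_map (x : blowup X) : blowup Y :=
  exist _ (blowup_map_fun (\val x)) (mem_set (blowup_map_subproof x)).

End BlowupMap.

Lemma blow_index_bij : orbit_representatives phi (bounded_parabolic phi) P' ->
  set_bij [set: blow_index] (bounded_parabolic phi) (fun i => \val (projT2 i)).
Proof.
move=> [P'P rep].
have bp (p : P') (q : orb p) : bounded_parabolic phi (\val q).
  apply: bounded_parabolic_orbit (set_mem (valP q)) _.
  exact: P'P (set_mem (valP p)).
split.
- by move=> [p q] _; exact: bp.
- move=> [p q] [p' q'] _ _ qq'; have {}qq' : \val q = \val q' by [].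
  have [p0 [_ uniq]] := rep _ (bp p q).
  have Ep : p = p'.
    apply: val_inj; transitivity p0.
      by apply/esym/uniq; split; exact: set_mem (valP _).
    apply: uniq; split; first exact: set_mem (valP p').
    by rewrite qq'; exact: set_mem (valP q').
  by case: p' / Ep q' qq' => q' qq'; congr existT; exact: val_inj.
- move=> q /rep[p [[P'p pq] _]].
  by exists (existT _ (exist _ p (mem_set P'p)) (exist _ q (mem_set pq))).
Qed.

End Blowup.

Arguments blowup {G Z phi P' H} HH K X.
Arguments blowup_act {G Z phi P' H} HH K X g x.
Arguments blowup_map {G Z phi P' H} HH K {X Y} f x.

(* Main.v *)
(** Everything rests on one consequence of perspectivity: since the translates
    [hF] of a finite set become small, [TF] has no limit points in [C] besides
    those of [T].  In the glued space [X_q] a closed set [A] accumulates where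
    the set of [h] with [hK] meeting [A] does, and by proper discontinuity a
    change of [K] (in particular its transport by an element of [G]) alters
    that set only by a finite right factor.  Hence [X_q] is compact Hausdorff
    and the maps [psi_q(g, -)] and [id + phi_q] are continuous.  The blowup is
    then a closed subspace of a compact Hausdorff product, and the remaining
    identities hold coordinate by coordinate. *)
From mathcomp Require Import all_boot.
From mathcomp Require Import all_classical topology reals urysohn Rstruct.
Require Import Defs.

Set Implicit Arguments.
Unset Strict Implicit.
Unset Printing Implicit Defensive.

Local Open Scope classical_set_scope.
Local Open Scope group_scope.

(** * Compact Hausdorff spaces *)

(** [I] is a bare type; [{classic I}] makes it a [choiceType] classically. *)
Lemma prod_coord_continuous (I : Type) (T : I -> topologicalType) (i : I) :
  continuous (fun f : prod_topology T => f i).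
Proof. exact: (@proj_continuous {classic I} T i). Qed.

Lemma prod_continuous (X : topologicalType) (I : Type)
    (T : I -> topologicalType) (f : X -> prod_topology T) :
  (forall i, continuous (fun x => f x i)) -> continuous f.
Proof.
move=> cf x; apply/cvg_sup => i.
move: x.
exact: (@continuous_comp_initial _ _ _ (fun g : forall i, T i => g i)).
Qed.

Lemma pair_continuous (X Y W : topologicalType) (f : X -> Y) (g : X -> W) :
  continuous f -> continuous g -> continuous (fun x => (f x, g x)).
Proof. by move=> cf cg x; exact: (cvg_pair (cf x) (cg x)). Qed.

Lemma prod_hausdorff (I : Type) (T : I -> topologicalType) :
  (forall i, hausdorff_space (T i)) -> hausdorff_space (prod_topology T).
Proof. exact: (@hausdorff_product {classic I}). Qed.

Lemma prod_compact (I : Type) (T : I -> topologicalType) :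
  (forall i, compact [set: T i]) -> compact [set: prod_topology T].
Proof.
move=> cT; rewrite (_ : setT = [set f : forall i, T i | forall i, setT (f i)]).
  exact: (@tychonoff {classic I} T (fun=> setT)).
by apply/seteqP.
Qed.

Lemma pair_hausdorff (X Y : topologicalType) :
  hausdorff_space X -> hausdorff_space Y -> hausdorff_space (X * Y)%type.
Proof.
move=> hX hY [x y] [x' y'] xy; congr pair.
  apply: hX => A B nA nB.
  have [] := xy (fst @^-1` A) (fst @^-1` B).
  - exact: (@cvg_fst _ _ (nbhs x) (nbhs y)).
  - exact: (@cvg_fst _ _ (nbhs x') (nbhs y')).
  by move=> z [Az Bz]; exists z.1.
apply: hY => A B nA nB.
have [] := xy (snd @^-1` A) (snd @^-1` B).
- exact: (@cvg_snd _ _ (nbhs x) (nbhs y)).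
- exact: (@cvg_snd _ _ (nbhs x') (nbhs y')).
by move=> z [Az Bz]; exists z.2.
Qed.

Lemma compact_image (X Y : topologicalType) (f : X -> Y) (A : set X) :
  continuous f -> compact A -> compact (f @` A).
Proof.
by move=> cf; apply: continuous_compact; exact: continuous_subspaceT.
Qed.

Lemma compact_set_val (X : topologicalType) (S A : set X) :
  compact A -> A `<=` S -> compact (set_val @^-1` A : set S).
Proof.
move=> cA AS F FF FA.
have [|x [Ax clx]] := cA (set_val @ F) _ _; first exact: FA.
exists (exist _ x (mem_set (AS _ Ax))); split=> // B D FB [_ [[W oW <-] Wx WU]].
have FB' : (set_val @ F) (set_val @` B).
  by apply: (@filterS _ F _ B) => // s Bs; exists s.
have [_ [[s Bs <-] Ws]] := clx _ _ FB' (open_nbhs_nbhs (conj oW Wx)).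
by exists s; split=> //; exact: WU.
Qed.

Lemma set_val_hausdorff (X : topologicalType) (S : set X) :
  hausdorff_space X -> hausdorff_space S.
Proof.
move=> hX s t st; apply: val_inj; apply: hX => A B sA tB.
have cv := @initial_continuous S X set_val.
by have [x [Ax Bx]] := st _ _ (cv s A sA) (cv t B tB); exists (set_val x).
Qed.

(* The Hausdorff property in terms of closed sets, which is how the topology of
   a gluing is described. *)
Definition closed_separated (T : topologicalType) (x y : T) : Prop :=
  exists A B : set T, [/\ closed A, closed B, A `|` B = setT, ~ A x & ~ B y].

Lemma closed_separated_sym (T : topologicalType) (x y : T) :
  closed_separated x y -> closed_separated y x.
Proof. by move=> [A [B [cA cB AB Ax By]]]; exists B, A; rewrite setUC. Qed.

Lemma hausdorff_closed_separated (T : topologicalType) :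
  hausdorff_space T <-> forall x y : T, x <> y -> closed_separated x y.
Proof.
rewrite open_hausdorff; split=> sT x y.
  move=> /eqP/sT[[A B] /= [/set_mem Ax /set_mem By] [oA oB /eqP AB0]].
  exists (~` A), (~` B); split; [exact: open_closedC|exact: open_closedC| | |].
  - by rewrite -setCI AB0 setC0.
  - by move/(_ Ax).
  - by move/(_ By).
move=> /eqP/sT[A [B [cA cB AB Ax By]]]; exists (~` A, ~` B).
  by split; exact: mem_set.
by split; [exact: closed_openC|exact: closed_openC|rewrite -setCU AB setCT].
Qed.

(** Compact Hausdorff spaces are normal, hence completely regular, hence uniformizable.
    Perspectivity speaks of entourages only, so a compatible uniformity must be exhibited before it
    yields anything. *)
Lemma compact_hausdorff_uniformity (T : topologicalType) :
  compact [set: T] -> hausdorff_space T ->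
  exists ent : set_system (T * T), compatible_uniformity ent.
Proof.
move=> cT hT.
(* Any [realType] would do here. *)
have crT := @normal_completely_regular Rdefinitions.R T
  (compact_normal hT cT) (hausdorff_accessible hT).
pose U : uniformType :=
  @completely_regular_uniformity.type Rdefinitions.R T crT.
exists (@entourage U); split.
- exact: (@entourage_filter U).
- by move=> A; exact: (@entourage_diagonal_subproof U).
- by move=> A; exact: (@entourage_inv U).
- by move=> A; exact: (@entourage_split_ex U).
- exact: esym (@nbhs_entourageE U).
Qed.

(** * Limit sets *)

Section GluingFacts.
Variables (V C : topologicalType) (f : gluing_map V C).

Definition glset (A : set V) (B : set C) : set (gluing f) :=
  [set x | match x with inl v => A v | inr c => B c end].

Lemma closed_glset A B :
  closed A -> closed B -> f A `<=` B -> closed (glset A B).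
Proof. by move=> cA cB fAB; apply/gluing_closedP. Qed.

Lemma glV_continuous : continuous (@glV V C f).
Proof. by apply/continuousP => U []. Qed.

(** The image of [A] is compact, hence already closed in the glued space, so its closure acquires no
    point of [C]. *)
Lemma gl_compact0 A :
  hausdorff_space (gluing f) -> closed A -> compact A -> f A = set0.
Proof.
move=> hf cA kA; rewrite -gluing_closure//; rewrite -subset0 => c /=.
have kA' : compact (glV @` A : set (gluing f)).
  by apply: compact_image kA; exact: glV_continuous.
by have /closure_id <- := compact_closed hf kA' => -[].
Qed.

End GluingFacts.

Arguments glset {V C} f A B.

Lemma glue_continuous (V C V' C' : topologicalType) (f : gluing_map V C)
    (f' : gluing_map V' C') (a : V -> V') (b : C -> C') :
  continuous a -> continuous b ->
  (forall A, closed A -> f (a @^-1` A) `<=` b @^-1` f' A) ->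
  continuous (glue f f' a b).
Proof.
move=> /continuousP ca /continuousP cb fab; apply/continuousP => U [oV oC fU].
split; [exact: (ca _ oV)|exact: (cb _ oC)|].
apply: subset_trans (fab _ (open_closedC oV)) _ => c; exact: fU.
Qed.

Section DiscreteGlue.
Variables (S S' : choiceType) (C C' : topologicalType).
Variables (d : gluing_map (discrete_topology S) C).
Variables (d' : gluing_map (discrete_topology S') C').
Variables (a : S -> S') (b : C -> C').

(** An open [U] in [C'] is tested through the open set made of all of [S'] and [U], whose complement
    has empty trace on [S']. *)
Lemma glue_continuousC : continuous (glue d d' a b) -> continuous b.
Proof.
move=> /continuousP cg; apply/continuousP => U oU.
have [] // := cg (glset d' setT U) _; split; [exact: openT|exact: oU|].
by move=> c; rewrite (_ : _ @^-1` _ = set0) ?gl0// -subset0 => x; exact.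
Qed.

(** The image of [T] under [a], together with its limit points, is closed; its preimage is closed
    and contains [T], hence also the limit points of [T]. *)
Lemma glue_continuous_sub T : continuous (glue d d' a b) ->
  d T `<=` b @^-1` d' (a @` T).
Proof.
move=> /continuous_closedP cg.
have dc (S0 : choiceType) (A : set (discrete_topology S0)) : closed A.
  exact: discrete_closed.
have /cg/gluing_closedP[_ _] : closed (glset d' (a @` T) (d' (a @` T))).
  apply: closed_glset; [exact: dc| |exact: subset_refl].
  by apply: gl_closed; exact: dc.
apply: subset_trans; apply: gl_sub; [exact: dc|exact: dc|].
by move=> t Tt; exact: (imageP a Tt).
Qed.

End DiscreteGlue.

(* [d T] is the set of limit points of [T] in [C]. *)
Definition right_absorbing (S : groupType) (C : topologicalType)
    (d : gluing_map (discrete_topology S) C) : Prop :=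
  forall T F : set S, finite_set F -> d [set t * f | t in T & f in F] `<=` d T.

Section Perspective.
Variables (S : groupType) (C : topologicalType).
Variable d : gluing_map (discrete_topology S) C.
Hypotheses (d_compact : compact [set: gluing d])
  (d_hausdorff : hausdorff_space (gluing d)).

Lemma gl_finite0 (A : set S) : finite_set A -> d A = set0.
Proof.
move=> fA; apply: gl_compact0 => //; first exact: discrete_closed.
exact: (@finite_compact (discrete_topology S)).
Qed.

(** If [c] is not a limit point of [T], some entourage keeps [T] away from it. For all but finitely
    many [t] the points [t * f] are close to [t], so they stay away from [c] too; the finitely many
    remaining products have no limit point. *)
Lemma perspective_right_absorbing : perspective d -> right_absorbing d.
Proof.
have dc (A : set (discrete_topology S)) : closed A by exact: discrete_closed.
move=> pd T F fF c dTF; apply: contrapT => dTc.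
have [ent entP] := compact_hausdorff_uniformity d_compact d_hausdorff.
have [entF _ entV entS entN] := entP.
have clT : closed (glset d T (d T)).
  apply: closed_glset; [exact: dc| |exact: subset_refl].
  by apply: gl_closed; exact: dc.
have : nbhs (glC c : gluing d) (~` (glset d T (d T))).
  by apply: open_nbhs_nbhs; split=> //; exact: closed_openC.
rewrite entN => -[A entA Asub].
have [B entB BA] := entS _ entA.
have eu : is_entourage (B `&` B^-1)%relation.
  by exists ent => //; apply: filterI => //; exact: entV.
(* Adjoining [1] to [F] makes smallness compare each [t * f] with [t] itself. *)
have /(pd _ eu) : finite_set (1 |` F).
  by rewrite finite_setU; split=> //; exact: finite_set1.
rewrite /=; set bad := (X in finite_set X) => fbad.
have : d [set t * f | t in T `\` bad & f in F] c.
  have fb : finite_set [set t * f | t in T `&` bad & f in F].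
    by apply: finite_image2 => //; exact: sub_finite_set fbad.
  have : d ([set t * f | t in T `&` bad & f in F] `|`
            [set t * f | t in T `\` bad & f in F]) c.
    apply: gl_sub dTF; [exact: dc|exact: dc|].
    move=> _ [t Tt [g Fg <-]]; have [bt|bt] := pselect (bad t).
      by left; exists t => //; exists g.
    by right; exists t => //; exists g.
  by rewrite glU; [rewrite gl_finite0// set0U|exact: dc|exact: dc].
rewrite -gluing_closure; last exact: dc.
move=> /(_ (xsection B (glC c))) [].
  by rewrite entN; exists B.
move=> _ [[_ [t [Tt nbad] [g Fg <-]] <-] /set_mem Bct].
have /contrapT/(_ (@glV _ _ d (t * g), @glV _ _ d t))[] := nbad.
  split; first by exists g => //; right.
  by exists 1; [left|rewrite mulg1].
move=> Btt _; have /Asub : xsection A (glC c) (@glV _ _ d t).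
  by apply/mem_set/BA; exists (@glV _ _ d (t * g)).
exact.
Qed.

End Perspective.

(** * The glued spaces *)

Section PiSpace.
Variables (S : groupType) (V C : topologicalType) (a : action S V) (K : set V).
Variable d : gluing_map (discrete_topology S) C.
Hypotheses (a_pd : properly_discontinuous a) (K_fund : fundamental_compact a K).

(** Proper discontinuity is stated for a single compact set; it is applied to the union of [L] and
    [M]. *)
Lemma compact_transporter_finite (L M : set V) : compact L -> compact M ->
  finite_set [set h | (a h @` L) `&` M !=set0].
Proof.
move=> cL cM; apply: sub_finite_set (a_pd (compactU cL cM)).
move=> h [_ [[x Lx <-] Mx]]; exists (a h x); split; last by right.
by exists x => //; left.
Qed.

(** If [h x] lies in [A] with [x] in [L], write [x] as [f k] with [k] in [K]: then [h * f] hits [A]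
    through [K], and the right factor [f^-1] recovers [h]. Only finitely many [f] occur,
    independently of [A]. *)
Lemma hits_translate (L : set V) : compact L ->
  exists2 F : set S, finite_set F &
    forall A, hits a L A `<=` [set s * f | s in hits a K A & f in F].
Proof.
move=> cL; have [cK KT] := K_fund.
exists ((fun h : S => h^-1) @` [set h | (a h @` K) `&` L !=set0]).
  by apply: finite_image; exact: compact_transporter_finite.
move=> A h [_ [[x Lx <-] Ahx]].
have : [set: V] x by []; rewrite -KT => -[f _ [k Kk fk]].
exists (h * f).
  by exists (a h x); split=> //; exists k => //; rewrite actM fk.
exists f^-1; last by rewrite -mulgA mulgV mulg1.
by exists f => //; exists x; split=> //; exists k.
Qed.

Hypotheses (d_compact : compact [set: gluing d])
  (d_hausdorff : hausdorff_space (gluing d)).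

Lemma Pi_compact0 (A : set V) : compact A -> Pi_fun a K d A = set0.
Proof.
move=> cA; apply: gl_finite0 => //.
by apply: compact_transporter_finite => //; exact: K_fund.1.
Qed.

(* A filter on the glued space is transferred to [gluing d] by replacing a set
   [A] with the set of those [h] whose tile [h K] meets [A]. *)
Lemma Pi_gluing_compact : compact [set: gluing (Pi_gluing a K d)].
Proof.
move=> F FF _; have [cK KT] := K_fund.
pose shadow (A : set (gluing (Pi_gluing a K d))) : set (gluing d) :=
  [set x | match x with
           | inl h => exists2 k, K k & A (glV (a h k))
           | inr c => A (glC c) end].
have shadowF : ProperFilter (filter_from F shadow).
  apply: filter_from_proper; first apply: filter_from_filter.
  - by exists setT; exact: filterT.
  - move=> A B FA FB; exists (A `&` B); first exact: filterI.
    by move=> [h [k Kk [Ak Bk]]|c []//]; split; exists k.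
  - move=> A FA; have [[v|c] Ax] := filter_ex FA; last by exists (glC c).
    have : [set: V] v by []; rewrite -KT => -[h _ [k Kk hk]].
    by exists (@glV _ _ d h); exists k => //; rewrite hk.
(* The shadows cluster either at a group element [h], which is isolated, so that every member of [F]
   meets the compact tile [h K], or at a boundary point [c]. *)
have [[h|c] [_ clw]] := d_compact shadowF filterT.
  have oh : open (~` (glset d (~` [set h]) setT)).
    apply: closed_openC; apply: closed_glset => //; exact: discrete_closed.
  have meet A : F A -> exists2 k, K k & A (glV (a h k)).
    have hh : (~` glset d (~` [set h]) setT) (glV h) by apply.
    move=> FA; have shA : filter_from F shadow (shadow A) by exists A.
    have [[h'|c] [Ax /= hx]] := clw _ _ shA (open_nbhs_nbhs (conj oh hh)) => //.
    by move: Ax; have -> : h' = h by exact: contrapT.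
  have KF : ProperFilter
      (filter_from F (fun A => K `&` [set k | A (glV (a h k))])).
    apply: filter_from_proper; first apply: filter_from_filter.
    - by exists setT; exact: filterT.
    - move=> A B FA FB; exists (A `&` B); first exact: filterI.
      by move=> k [Kk [Ak Bk]].
    - by move=> A /meet[k Kk Ak]; exists k.
  have [|k [Kk clk]] := cK _ KF.
    by exists setT; [exact: filterT|move=> k []].
  exists (glV (a h k)); split=> // A B FA nB.
  have nk : nbhs k ((glV \o a h) @^-1` B).
    apply: (@continuous_comp _ _ _ (a h)) => //; first exact: act_continuous.
    exact: glV_continuous.
  have [|x [[_ Ax] Bx]] := clk (K `&` [set k | A (glV (a h k))]) _ _ nk.
    by exists A.
  by exists (glV (a h x)).
exists (glC c); split=> // A B FA; rewrite nbhsE => -[U [oU Uc] UB].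
have [oUV oUC dU] := oU.
(* This neighbourhood of [c] in [gluing d] consists of the part of [U] in [C] and of those [h] whose
   whole tile lies in [U]. It is open because [dU] bounds the limit points of the excluded [h]. *)
have oT : open (~` (glset d (hits a K (glV @^-1` (~` U))) (glC @^-1` (~` U)))).
  apply: closed_openC; apply: closed_glset => //; first exact: discrete_closed.
  by rewrite preimage_setC; exact: open_closedC.
have cT : (~` glset d (hits a K (glV @^-1` (~` U))) (glC @^-1` (~` U))) (glC c).
  by apply.
have shA : filter_from F shadow (shadow A) by exists A.
have [[h|c'] [Ax nx]] := clw _ _ shA (open_nbhs_nbhs (conj oT cT)).
- have [k Kk Ak] := Ax; exists (glV (a h k)); split=> //; apply: UB.
  by apply: contrapT => nU; apply: nx; exists (a h k); split=> //; exists k.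
- by exists (glC c'); split=> //; apply: UB; exact: contrapT.
Qed.

Hypotheses (V_hausdorff : hausdorff_space V)
  (V_lcompact : forall v : V, exists2 N, nbhs v N & compact N)
  (d_absorbing : right_absorbing d).

(** The tiles are locally finite: a compact neighbourhood of [v] meets only finitely many of them,
    and each is compact, hence closed. *)
Lemma tiles_closed (T : set S) : closed (\bigcup_(h in T) a h @` K).
Proof.
move=> v clv; have [N nN cN] := V_lcompact v.
pose T' := [set h | (a h @` K) `&` N !=set0].
have cT' : closed (\bigcup_(h in T `&` T') a h @` K).
  apply: closed_bigcup.
    have fT' : finite_set T'.
      by apply: compact_transporter_finite => //; exact: K_fund.1.
    by apply: sub_finite_set fT' => h [].
  move=> h _; apply: compact_closed => //; apply: compact_image K_fund.1.
  exact: act_continuous.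
suff : (\bigcup_(h in T `&` T') a h @` K) v by case=> h [Th _] hv; exists h.
apply: cT' => B nB; have [x [[h Th hx] [Nx Bx]]] := clv _ (filterI nN nB).
by exists x; split=> //; exists h => //; split=> //; exists x.
Qed.

(** The main case is that of two boundary points: they are separated in [gluing d], and the
    separating closed sets are carried over by replacing each group element with its tile. *)
Lemma Pi_gluing_hausdorff : hausdorff_space (gluing (Pi_gluing a K d)).
Proof.
have [cK KT] := K_fund.
(* A compact neighbourhood of [v] has no limit point in [C], so it is closed in the glued space
   without adding any boundary point. *)
have sepVC v c : closed_separated (glV v : gluing (Pi_gluing a K d)) (glC c).
  have [N nN cN] := V_lcompact v; have clN := compact_closed V_hausdorff cN.
  exists (glset _ (~` interior N) setT), (glset _ N set0); split.
  - apply: closed_glset => //; apply: open_closedC; exact: open_interior.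
  - apply: closed_glset => //; first exact: closed0.
    by rewrite (Pi_compact0 cN : Pi_gluing a K d N = set0).
  - apply/seteqP; split=> // -[x|x] _ /=; last by left.
    have [Nx|Nx] := pselect (interior N x); last by left.
    by right; exact: interior_subset.
  - by [].
  - by [].
apply/hausdorff_closed_separated => -[v|c] [w|c'] xy.
- have [|A [B [cA cB AB Av Bw]]] :=
    (hausdorff_closed_separated V).1 V_hausdorff v w.
    by move=> vw; apply: xy; rewrite vw.
  exists (glset _ A setT), (glset _ B setT).
  split; [exact: closed_glset|exact: closed_glset| |by []|by []].
  apply/seteqP; split=> // -[x|x] _; last by left.
  by have : setT x by []; rewrite -AB.
- exact: sepVC.
- exact/closed_separated_sym/sepVC.
- have [|A [B [cA cB AB Av Bw]]] :=
    (hausdorff_closed_separated (gluing d)).1 d_hausdorff (glC c) (glC c').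
    by move=> [cc']; apply: xy; rewrite cc'.
  pose tile (A : set (gluing d)) := glset (Pi_gluing a K d)
    (\bigcup_(h in (@glV _ _ d) @^-1` A) a h @` K) (glC @^-1` A).
  have closed_tile A0 : closed A0 -> closed (tile A0).
    move=> /gluing_closedP[cV cC dA]; apply: closed_glset => //.
      exact: tiles_closed.
    apply: subset_trans dA; rewrite /= /Pi_fun.
    (* If [h K] meets [h' K], then [h'^-1 * h] lies in the finite set of elements moving [K] to meet
       itself, and [d] absorbs this right factor. *)
    apply: subset_trans (@d_absorbing _ _ (a_pd cK)).
    apply: gl_sub; [exact: discrete_closed|exact: discrete_closed|].
    move=> h [_ [[k Kk <-] [h' Ah' [k' Kk' hk]]]].
    exists h' => //; exists (h'^-1 * h); last by rewrite mulgA mulgV mul1g.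
    by exists k'; split=> //; exists k => //; rewrite actM -hk actK.
  exists (tile A), (tile B).
  split; [exact: closed_tile|exact: closed_tile| |by []|by []].
  apply/seteqP; split=> // -[x|x] _.
    have : [set: V] x by []; rewrite -KT => -[h _ hx].
    have : [set: gluing d] (@glV _ _ d h) by []; rewrite -AB => -[Ah|Bh].
      by left; exists h.
    by right; exists h.
  by have : [set: gluing d] (glC x) by []; rewrite -AB => -[]; [left|right].
Qed.

End PiSpace.

(** If [s K] meets the preimage of [A], then [tau s] moves the compact set [m K] to meet [A];
    passing from [m K] to [K'] costs a finite right factor, which [d'] absorbs. This serves both for
    the maps [psi_q(g, -)] and for [id + phi_q]. *)
Lemma Pi_glue_continuous (S S' : groupType) (V V' C C' : topologicalType)
    (a : action S V) (a' : action S' V') (K : set V) (K' : set V')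
    (d : gluing_map (discrete_topology S) C)
    (d' : gluing_map (discrete_topology S') C')
    (tau : S -> S') (m : V -> V') (b : C -> C') :
  compact K -> properly_discontinuous a' -> fundamental_compact a' K' ->
  right_absorbing d' ->
  continuous m -> (forall s v, m (a s v) = a' (tau s) (m v)) ->
  continuous b -> (forall T, d T `<=` b @^-1` d' (tau @` T)) ->
  continuous (glue (Pi_gluing a K d) (Pi_gluing a' K' d') m b).
Proof.
move=> cK pd' fK' abs' cm mE cb bd; apply: glue_continuous => // A cA c dc.
have [F fF hitsF] := hits_translate pd' fK' (compact_image cm cK).
apply: (abs' _ _ fF); apply: gl_sub (bd _ _ dc); try exact: discrete_closed.
apply: subset_trans (hitsF A) => _ [s [_ [[k Kk <-] Ask]] <-].
exists (m (a s k)); split=> //; exists (m k); first by exists k.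
by rewrite mE.
Qed.

(** * Transport of a boundary map along a bijection *)

Section Pull.
Variables (S S' : groupType) (f : S -> S') (C : topologicalType).
Variable d : gluing_map (discrete_topology S') C.
Hypothesis f_bij : bijective f.

Lemma pull_compact :
  compact [set: gluing d] -> compact [set: gluing (pull_gluing f d)].
Proof.
have [g fK gK] := f_bij; have [_ cg] := pull_gluing_homeo d fK gK.
move=> /(compact_image cg); congr compact; apply/seteqP; split=> // x _.
exists (glue (pull_gluing f d) d f id x) => //.
by case: x => x //=; rewrite fK.
Qed.

Lemma pull_hausdorff :
  hausdorff_space (gluing d) -> hausdorff_space (gluing (pull_gluing f d)).
Proof.
have [g fK gK] := f_bij; have [cf _] := pull_gluing_homeo d fK gK.
set F := glue _ _ _ _ in cf.
move=> hd x y xy; have : F x = F y.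
  apply: hd => A B xA yB; have [z [Az Bz]] := xy _ _ (cf x A xA) (cf y B yB).
  by exists (F z).
by case: x y {xy} => x [] y //= [] => [/(can_inj fK)|] ->.
Qed.

Lemma pull_absorbing : (forall s t, f (s * t) = f s * f t) ->
  right_absorbing d -> right_absorbing (pull_gluing f d).
Proof.
move=> fM abs T F fF; apply: subset_trans (abs _ _ (finite_image f fF)).
apply: (@gl_sub _ _ d); [exact: discrete_closed|exact: discrete_closed|].
move=> _ [_ [s Ts [t Ft <-]] <-]; exists (f s); first by exists s.
by exists (f t); [exists t|rewrite fM].
Qed.

End Pull.

Section EPersFacts.
Variables (S : groupType) (X : epers_ob S).

Lemma ep_absorbing : right_absorbing (ep_d X).
Proof.
apply: perspective_right_absorbing; first exact: ep_compact.
  exact: ep_hausdorff.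
exact: ep_perspective.
Qed.

Lemma ep_eta_continuous s : continuous (@ep_eta S X s).
Proof. exact: glue_continuousC ((ep_act X).2 s). Qed.

Lemma ep_eta_sub s T :
  ep_d X T `<=` @ep_eta S X s @^-1` ep_d X [set s * t | t in T].
Proof. exact: glue_continuous_sub ((ep_act X).2 s). Qed.

Lemma ep_eta1 c : @ep_eta S X 1 c = c.
Proof. by have [[/(_ (glC c)) [->]]] := ep_act X. Qed.

Lemma ep_etaM s t c : @ep_eta S X (s * t) c = @ep_eta S X s (@ep_eta S X t c).
Proof. by have [[_ /(_ s t (glC c)) [->]]] := ep_act X. Qed.

End EPersFacts.

(** Separate [v] from [q] by closed sets: the one avoiding [q] is a neighbourhood of [v] and, being
    closed in [Z], is compact. *)
Lemma punctured_lcompact (Z : topologicalType) (q : Z) :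
  compact [set: Z] -> hausdorff_space Z ->
  forall v : punctured q, exists2 N, nbhs v N & compact N.
Proof.
move=> cZ hZ v; have vq : \val v <> q by exact: set_mem (valP v).
have [A [B [cA cB AB Av Bq]]] := (hausdorff_closed_separated Z).1 hZ _ _ vq.
exists (set_val @^-1` B).
  apply: (@initial_continuous _ _ (set_val : punctured q -> Z)).
  have oA : open (~` A) by exact: closed_openC.
  apply: filterS (open_nbhs_nbhs (conj oA Av)) => z nAz.
  by have : [set: Z] z by []; rewrite -AB => -[].
apply: compact_set_val; first exact: subclosed_compact cB cZ _.
by move=> z Bz zq; apply: Bq; rewrite -zq.
Qed.

(** * The blowup *)

Section BlowupFacts.
Variables (G : groupType) (Z : topologicalType).
Hypotheses (Z_compact : compact [set: Z]) (Z_hausdorff : hausdorff_space Z).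
Variables (phi : action G Z) (P' : set Z).
Hypothesis P'_parabolic : P' `<=` bounded_parabolic phi.
Variables (H : P' -> set G).
Hypothesis HH : forall p : P', minimal_orbit_cover phi (\val p) (H p).
Variable K : forall q : Z, set (punctured q).
Hypothesis K_fundamental : forall q : Z, bounded_parabolic phi q ->
  fundamental_compact (stab_act phi q) (@K q).

Local Notation orb p := (orbit phi (\val p) : Type).

Lemma orb_parabolic (p : P') (q : orb p) : bounded_parabolic phi (\val q).
Proof.
apply: bounded_parabolic_orbit (set_mem (valP q)) _.
exact: P'_parabolic (set_mem (valP p)).
Qed.

Lemma stab_conjM (p : P') (q : orb p) (s t : Stab phi (\val q)) :
  stab_conj HH (s * t) = stab_conj HH s * stab_conj HH t.
Proof. by apply: val_inj => /=; rewrite !mulgA mulgK. Qed.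

Section Space.
Variable X : forall p : P', EPers (Stab phi (\val p)).

Let d_compact (p : P') (q : orb p) : compact [set: gluing (blow_d HH X q)].
Proof. apply: pull_compact; [exact: stab_conj_bij|exact: ep_compact]. Qed.

Let d_hausdorff (p : P') (q : orb p) : hausdorff_space (gluing (blow_d HH X q)).
Proof. apply: pull_hausdorff; [exact: stab_conj_bij|exact: ep_hausdorff]. Qed.

Let d_absorbing (p : P') (q : orb p) : right_absorbing (blow_d HH X q).
Proof. apply: pull_absorbing; [exact: stab_conjM|exact: ep_absorbing]. Qed.

Lemma blow_at_compact (p : P') (q : orb p) : compact [set: blow_at HH K X q].
Proof.
have bq := orb_parabolic q.
by apply: Pi_gluing_compact; [exact: K_fundamental|exact: d_compact].
Qed.

Lemma blow_at_hausdorff (p : P') (q : orb p) :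
  hausdorff_space (blow_at HH K X q).
Proof.
have bq := orb_parabolic q; apply: Pi_gluing_hausdorff.
- exact: bq.1.
- exact: K_fundamental.
- exact: d_hausdorff.
- exact: set_val_hausdorff.
- exact: punctured_lcompact.
- exact: d_absorbing.
Qed.

(** At the points of [C_q], the complement of an open [U] containing [q] must not accumulate; it is
    a compact subset of the punctured space. *)
Lemma blow_proj_continuous (p : P') (q : orb p) :
  continuous (@blow_proj _ _ _ _ _ HH K X p q).
Proof.
apply/continuousP => U oU; split.
- by exists U.
- have [Uq|nUq] := pselect (U (\val q)).
    by rewrite (_ : _ @^-1` _ = setT); [exact: openT|apply/seteqP; split].
  by rewrite (_ : _ @^-1` _ = set0); [exact: open0|rewrite -subset0].
have bq := orb_parabolic q.
have cU : U (\val q) ->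
    compact (set_val @^-1` (~` U) : set (punctured (\val q))).
  move=> Uq; apply: compact_set_val.
    by apply: subclosed_compact Z_compact _ => //; exact: open_closedC.
  by move=> z nUz zq; apply: nUz; rewrite zq.
move=> c dc Uq; have := Pi_compact0 bq.1 (K_fundamental bq)
  (@d_hausdorff _ q) (cU Uq).
by rewrite -subset0 => /(_ c); apply.
Qed.

Lemma blow_move_continuous (p : P') (q q' : orb p) g
    (e : phi g (\val q) = \val q') :
  continuous (@blow_move _ _ _ _ _ HH K X _ _ _ _ e).
Proof.
have sP (s : Stab phi (\val q)) : phi (g * \val s * g^-1) (\val q') = \val q'.
  by rewrite !actM -e actK StabP.
have bq := orb_parabolic q; have bq' := orb_parabolic q'.
apply: (@Pi_glue_continuous _ _ _ _ _ _ _ _ _ _ _ _ (fun s => mkStab (sP s))).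
- exact: (K_fundamental bq).1.
- exact: bq'.1.
- exact: K_fundamental.
- exact: d_absorbing.
- exact: punctured_move_continuous.
- by move=> s v; apply: val_inj; rewrite /= !actM actK.
- exact: ep_eta_continuous.
(* With [k] the holonomy of [g], one has [k * stab_conj s = stab_conj (g s g^-1) * k]. The left
   factor [k] is accounted for by [eta_p], and the right one is absorbed. *)
move=> T c /= dT.
apply: (@ep_absorbing _ (X p) _ [set holonomy HH e]); first exact: finite_set1.
apply: gl_sub (@ep_eta_sub _ _ (holonomy HH e) _ _ dT);
  try exact: discrete_closed.
move=> _ [_ [s Ts <-] <-]; exists (stab_conj HH (mkStab (sP s))).
  by exists (mkStab (sP s)) => //; exists s.
exists (holonomy HH e) => //; apply: val_inj => /=.
by rewrite !mulgA !mulgK !mulgVK.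
Qed.

(** [q] and [q'] are kept apart and [x] is a whole family over the orbit, so that [x q] and [x q']
    are typed without transport. Once [q = q'] is substituted, the holonomy is [1]. *)
Lemma blow_move1 (p : P') (q q' : orb p) (e : phi 1 (\val q) = \val q')
    (x : forall q : orb p, blow_at HH K X q) :
  blow_move e (x q) = x q'.
Proof.
have qq' : q = q' by apply: val_inj; rewrite -e act1.
case: q' / qq' e => e; case: (x q) => [z|c]; rewrite /blow_move /=.
  by congr inl; apply: val_inj; rewrite /= act1.
congr inr; rewrite (_ : holonomy HH e = 1) ?ep_eta1//.
by apply: val_inj; rewrite /= mulg1 mulVg.
Qed.

(** The holonomies of [g] and [h] multiply to that of [g * h], since the transporter of the
    intermediate point [q1] cancels. *)
Lemma blow_moveM (p : P') (q q' q1 q2 : orb p) g h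
    (e : phi (g * h) (\val q) = \val q2)
    (eh : phi h (\val q') = \val q1) (eg : phi g (\val q1) = \val q2)
    (x : forall q : orb p, blow_at HH K X q) :
  blow_move e (x q) = blow_move eg (blow_move eh (x q')).
Proof.
have qq' : q = q'.
  apply: val_inj; apply: (can_inj (actK phi (g * h))).
  by rewrite e actM eh eg.
case: q' / qq' eh => eh; case: (x q) => [z|c]; rewrite /blow_move /=.
  by congr inl; apply: val_inj; rewrite /= actM.
congr inr; rewrite -ep_etaM; congr ep_eta.
by apply: val_inj; rewrite /= !mulgA mulgK.
Qed.

Local Notation ambient :=
  (Z * prod_topology
    (fun i : blow_index phi P' => blow_at HH K X (projT2 i)))%type.

Lemma blow_coord_continuous (i : blow_index phi P') :
  continuous (fun zx : ambient => zx.2 i).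
Proof.
pose T (j : blow_index phi P') := blow_at HH K X (projT2 j).
move=> zx; apply: (@continuous_comp ambient (prod_topology T) (T i) snd
  (fun x => x i)); first exact: cvg_snd.
exact: prod_coord_continuous.
Qed.

(** Each condition equates two continuous maps into the Hausdorff space [Z]. *)
Lemma blow_compatible_closed : closed (@blow_compatible _ _ _ _ _ HH K X).
Proof.
rewrite (_ : blow_compatible (X:=X) = \bigcap_(i in setT)
  [set zx : ambient | blow_proj (zx.2 i) = zx.1]); last first.
  by apply/seteqP; split=> [zx zxP i _|zx zxP i]; exact: zxP.
apply: closed_bigI => i _ zx clzx; apply: Z_hausdorff => A B zxA zxB.
pose pr (zx : ambient) := blow_proj (zx.2 i).
have cproj : {for zx, continuous pr}.
  apply: (@continuous_comp _ _ _ (fun zx : ambient => zx.2 i)).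
    exact: blow_coord_continuous.
  exact: blow_proj_continuous.
have nA : nbhs zx (pr @^-1` A) := cproj A zxA.
have nB : nbhs zx (fst @^-1` B) by exact: cvg_fst.
have [y [yi [Ay By]]] := clzx _ (filterI nA nB).
by exists y.1; split=> //; rewrite -yi.
Qed.

Lemma blowup_compact : compact [set: blowup HH K X].
Proof.
rewrite (_ : setT =
  set_val @^-1` (@blow_compatible _ _ _ _ _ HH K X)); last first.
  by apply/seteqP; split=> // x _; exact: set_mem (valP x).
apply: compact_set_val => //.
apply: (subclosed_compact blow_compatible_closed (B := setT)) => //.
rewrite -setXTT; apply: compact_setX => //.
by apply: prod_compact => i; exact: blow_at_compact.
Qed.

Lemma blowup_hausdorff : hausdorff_space (blowup HH K X).
Proof.
apply: set_val_hausdorff; apply: pair_hausdorff => //.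
by apply: prod_hausdorff => i; exact: blow_at_hausdorff.
Qed.

Lemma continuous_blowup (T : topologicalType) (f : T -> blowup HH K X) :
  continuous (fun t => (\val (f t)).1) ->
  (forall i, continuous (fun t => (\val (f t)).2 i)) -> continuous f.
Proof.
move=> cf1 cf2; apply: (@continuous_comp_initial _ _ _ set_val).
rewrite (_ : set_val \o f = fun t => ((\val (f t)).1, (\val (f t)).2)).
  by apply: pair_continuous; [exact: cf1|exact: prod_continuous].
by apply/funext => s /=; rewrite -surjective_pairing.
Qed.

Lemma blowup_base_continuous :
  continuous (fun x : blowup HH K X => (\val x).1).
Proof.
move=> x; apply: (@continuous_comp _ _ _ set_val fst); last exact: cvg_fst.
exact: initial_continuous.
Qed.

Lemma blowup_coord_continuous i :
  continuous (fun x : blowup HH K X => (\val x).2 i).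
Proof.
move=> x; apply: (@continuous_comp _ _ _ set_val (fun zx : ambient => zx.2 i)).
  exact: initial_continuous.
exact: blow_coord_continuous.
Qed.

Lemma blowup_act_continuous g : continuous (blowup_act HH K X g).
Proof.
apply: continuous_blowup => [|i] x.
  apply: (@continuous_comp _ _ _ (fun x : blowup HH K X => (\val x).1) (phi g)).
    exact: blowup_base_continuous.
  exact: act_continuous.
pose j : blow_index phi P' := existT _ (projT1 i) (orbit_pred g (projT2 i)).
pose coord (x : blowup HH K X) := (\val x).2 j.
have cm : continuous (blow_move (orbit_predK g (projT2 i)) :
    blow_at HH K X (projT2 j) -> blow_at HH K X (projT2 i)).
  exact: blow_move_continuous.
have cc : continuous coord by exact: blowup_coord_continuous.
exact: (continuous_comp (cc x) (cm _)).
Qed.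

Lemma blowup_ext (x y : blowup HH K X) : (\val x).1 = (\val y).1 ->
  (forall i, (\val x).2 i = (\val y).2 i) -> x = y.
Proof.
move=> xy1 xy2; apply: val_inj.
rewrite [LHS]surjective_pairing [RHS]surjective_pairing xy1; congr pair.
exact: functional_extensionality_dep.
Qed.

Lemma blowup_act_object : act_object (blowup_act HH K X).
Proof.
split; [exact: blowup_compact|exact: blowup_hausdorff|].
split; last exact: blowup_act_continuous.
split=> [x|g h x]; apply: blowup_ext => [|[p q]] /=; rewrite ?act1 ?actM //.
  exact: (blow_move1 _ (fun q => (\val x).2 (existT _ p q))).
exact: (blow_moveM _ _ _ (fun q => (\val x).2 (existT _ p q))).
Qed.

End Space.

(** * Induced maps between blowups *)

Section Maps.
Variables X Y : forall p : P', EPers (Stab phi (\val p)).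
Variable f : forall p : P', Hom (X p) (Y p).

Lemma blow_map_continuous (p : P') (q : orb p) :
  continuous (@blow_map _ _ _ _ _ HH K _ _ f p q).
Proof.
have bq := orb_parabolic q.
have cf := glue_continuousC (@eh_continuous _ _ _ (f p)).
apply: (@Pi_glue_continuous _ _ _ _ _ _ _ _ _ _ _ _ id) => //.
- exact: (K_fundamental bq).1.
- exact: bq.1.
- exact: K_fundamental.
- apply: pull_absorbing; [exact: stab_conjM|exact: ep_absorbing].
- by move=> v; exact: cvg_id.
(* Both boundary maps are pulled back along the same [stab_conj], so the inclusion is the one given
   by continuity of [id + phi_p], taken at the image of [T]. *)
move=> T; rewrite image_id.
have := glue_continuous_sub (T := @stab_conj _ _ _ _ _ HH _ q @` T)
  (@eh_continuous _ _ _ (f p)).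
by rewrite image_id.
Qed.

Lemma blowup_map_morphism :
  act_morphism (blowup_act HH K X) (blowup_act HH K Y) (blowup_map HH K f).
Proof.
split.
  apply: continuous_blowup => [|i] x; first exact: blowup_base_continuous.
  apply: (@continuous_comp _ _ _ (fun x : blowup HH K X => (\val x).2 i)
    (@blow_map _ _ _ _ _ HH K _ _ f _ (projT2 i))).
    exact: blowup_coord_continuous.
  exact: blow_map_continuous.
move=> g x; apply: blowup_ext => //= i.
by case: ((\val x).2 _) => //= c; rewrite eh_equivariant.
Qed.

End Maps.

End BlowupFacts.

Theorem proposition2p11 (G : groupType) (Z : topologicalType)
    (Z_compact : compact [set: Z]) (Z_hausdorff : hausdorff_space Z)
    (phi : action G Z)
    (P' : set Z)
    (P'_repr : orbit_representatives phi (bounded_parabolic phi) P')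
    (H : P' -> set G)
    (H_minimal : forall p : P', minimal_orbit_cover phi (\val p) (H p))
    (K : forall q : Z, set (punctured q))
    (K_fundamental : forall q : Z, bounded_parabolic phi q ->
       fundamental_compact (stab_act phi q) (K q)) :
  let C := prod_category (fun p : P' => EPers (Stab phi (\val p))) in
  exists (ob_axiom : forall X : C,
            act_object (blowup_act H_minimal K X))
         (hom_axiom : forall (X Y : C) (f : Hom X Y),
            act_morphism (blowup_act H_minimal K X) (blowup_act H_minimal K Y)
              (blowup_map H_minimal K f)),
    @is_functor C (Act G)
      (fun X => ActOb (ob_axiom X))
      (fun X Y f => @ActHom G (ActOb (ob_axiom X)) (ActOb (ob_axiom Y))
                      (blowup_map H_minimal K f) (hom_axiom X Y f)).
Proof.
have P'P := P'_repr.1.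
exists (blowup_act_object Z_compact Z_hausdorff P'P H_minimal K_fundamental).
exists (blowup_map_morphism P'P H_minimal K_fundamental).
(* Morphisms of [Act] are determined by their functions, and each coordinate lies in one of two
   summands, on which [glue] computes. *)
split=> [X|X Y W f g]; apply: act_hom_eq; apply/funext => x /=;
  apply: blowup_ext => //= i; by case: ((\val x).2 i).
Qed.
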